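(* Let $p\le n$ be positive integers, $\rho>0$, and $X\in\mathrm{Sp}(2p,2n)$. The normal space of $\mathrm{Sp}(2p,2n)$ at $X$ with respect to $g_\rho$ is $$\left(\mathrm{T}_X\mathrm{Sp}(2p,2n)\right)^\perp=\{XJ_{2p}\Omega:\Omega\in\mathcal{S}_{\mathrm{skew}}(2p)\}.$$
   Context: For a positive integer $m$, $J_{2m}=\begin{bmatrix} 0 & I_m \\ -I_m & 0 \end{bmatrix}$, and $\mathcal{S}_{\mathrm{skew}}(m)$ is the set of skew-symmetric $m\times m$ real matrices. The symplectic Stiefel manifold is $\mathrm{Sp}(2p,2n)=\{X\in\mathbb{R}^{2n\times 2p}: X^\top J_{2n}X=J_{2p}\}$, an embedded submanifold of $\mathbb{R}^{2n\times 2p}$, with tangent space $\mathrm{T}_X\mathrm{Sp}(2p,2n)$ at $X$. Let $X_\perp\in\mathbb{R}^{2n\times(2n-2p)}$ be a full rank matrix whose columns span the orthogonal complement of the column span of $X$ (the empty matrix when $p=n$); then $X_\perp^\top J_{2n}X_\perp$ and $E=[XJ_{2p}\;\;J_{2n}X_\perp]$ are invertible. The inner product $g_\rho$ (at $X$, depending also on the choice of $X_\perp$) on $\mathbb{R}^{2n\times 2p}$ is $$g_\rho(Z_1,Z_2)=\tfrac1\rho\mathrm{tr}(W_1^\top W_2)+\mathrm{tr}(K_1^\top K_2)=\mathrm{tr}(Z_1^\top B_XZ_2),\qquad \begin{bmatrix} W_i \\ K_i \end{bmatrix}=E^{-1}Z_i,$$ with $B_X=E^{-\top}\begin{bmatrix}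 \frac1\rho I_{2p} & 0 \\ 0 & I_{2n-2p} \end{bmatrix}E^{-1}$. The normal space is defined by $\left(\mathrm{T}_X\mathrm{Sp}(2p,2n)\right)^\perp=\{N\in\mathbb{R}^{2n\times 2p}: g_\rho(N,Z)=0\text{ for all }Z\in\mathrm{T}_X\mathrm{Sp}(2p,2n)\}$. *)

(* Defs.v *)
From mathcomp Require Import all_boot all_order all_algebra.
From mathcomp Require Import all_classical all_reals all_analysis.
Import Order.TTheory GRing.Theory Num.Theory.
Import numFieldNormedType.Exports.

Set Implicit Arguments.
Unset Strict Implicit.
Unset Printing Implicit Defensive.

Local Open Scope classical_set_scope.
Local Open Scope ring_scope.

(* Throughout, 2m is written m + m, so that m x m blocks need no casts. *)

Definition J2 (R : realType) (m : nat) : 'M[R]_(m + m) :=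
  block_mx 0 1%:M (- 1%:M) 0.
Arguments J2 {R} m.

Definition skew_mx (R : realType) (m : nat) : set 'M[R]_m :=
  [set A | A^T = - A].

Definition sympl_stiefel (R : realType) (p n : nat) : set 'M[R]_(n + n, p + p) :=
  [set X | X^T *m J2 n *m X = J2 p].

(* The tangent space of an embedded submanifold M at X, as the set of the
   velocities at time 0 of the smooth curves of M through X. Derivatives are
   those of functions from R to the normed space of matrices. *)
Definition tangent_space (R : realType) (m k : nat) (M : set 'M[R]_(m, k))
    (X : 'M[R]_(m, k)) : set 'M[R]_(m, k) :=
  [set Z : 'M[R]_(m, k) | exists (e : R) (gamma : R -> 'M[R]_(m, k)),
    [/\ 0 < e,
        forall t : R, `|t| < e -> M (gamma t),
        forall (i : nat) (t : R), `|t| < e -> derivable (derive1n i gamma) t 1,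
        gamma 0 = X &
        derive1 gamma 0 = Z]].

Definition col_span (R : realType) (m k : nat) (A : 'M[R]_(m, k)) : set 'cV[R]_m :=
  [set A *m w | w in [set: 'cV[R]_k]].

Definition orth_compl (R : realType) (m : nat) (S : set 'cV[R]_m) : set 'cV[R]_m :=
  [set v | forall u, S u -> u^T *m v = 0].

Definition is_perp (R : realType) (p n : nat) (X : 'M[R]_(n + n, p + p))
    (Xp : 'M[R]_(n + n, n + n - (p + p))) : Prop :=
  \rank Xp = (n + n - (p + p))%N /\ col_span Xp = orth_compl (col_span X).

Lemma dimE (p n : nat) : (p <= n)%N -> (p + p + (n + n - (p + p)) = n + n)%N.
Proof. by move=> le_pn; exact: subnKC (leq_add le_pn le_pn). Qed.

Section Metric.
Variables (R : realType) (p n : nat) (le_pn : (p <= n)%N) (rho : R).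
Variables (X : 'M[R]_(n + n, p + p)) (Xp : 'M[R]_(n + n, n + n - (p + p))).

Definition Emx : 'M[R]_(n + n, p + p + (n + n - (p + p))) :=
  row_mx (X *m J2 p) (J2 n *m Xp).

(* E is square only up to the equality dimE, hence the casts; invmx is the
   actual inverse because E is invertible whenever X is in Sp(2p, 2n) and
   is_perp X Xp holds. *)
Definition Einv : 'M[R]_(p + p + (n + n - (p + p)), n + n) :=
  castmx (esym (dimE le_pn), erefl)
    (invmx (castmx (erefl, dimE le_pn) Emx)).

Definition Wpart (Z : 'M[R]_(n + n, p + p)) : 'M[R]_(p + p) :=
  usubmx (Einv *m Z).

Definition Kpart (Z : 'M[R]_(n + n, p + p)) : 'M[R]_(n + n - (p + p), p + p) :=
  dsubmx (Einv *m Z).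

Definition g_rho (Z1 Z2 : 'M[R]_(n + n, p + p)) : R :=
  rho^-1 * \tr ((Wpart Z1)^T *m Wpart Z2) + \tr ((Kpart Z1)^T *m Kpart Z2).

Definition normal_space_rho : set 'M[R]_(n + n, p + p) :=
  [set N | forall Z, tangent_space (@sympl_stiefel R p n) X Z -> g_rho N Z = 0].

End Metric.

(* Main.v *)
Require Import Defs.
From mathcomp Require Import all_boot all_order all_algebra.
From mathcomp Require Import all_classical all_reals all_analysis.
Import Order.TTheory GRing.Theory Num.Theory.
Import numFieldNormedType.Exports.

(** The normal space is dual to the tangent space, so a full description of
    the tangent space is avoided: an inclusion of it in a linear space, and a
    supply of tangent vectors, each settle one inclusion of the theorem. Write
    J for the symplectic matrix of size 2n or 2p, E = [XJ  JX_perp], and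
    (W_Z, K_Z) for the coordinates of Z in the frame E. Everything is read off
    in this frame, through the identity X^T J E = [-1  0] ([XJ_Emx]). With the
    full rank of X_perp, it also makes E injective, hence invertible.

    Upper bound on the tangent space ([tangent_sympl_stiefel_linearized]):
    gamma^T J gamma is constant along a curve gamma in the manifold, and its
    derivative at time 0 gives Z^T J X + X^T J Z = 0. As X^T J Z = - W_Z, this
    says that W_Z is symmetric. The matrix XJ Omega has coordinates (Omega, 0),
    so for Omega skew its product with Z is tr(Omega^T W_Z) / rho = 0.

    Lower bound ([sympl_stiefel_transvection]): the transvection
    v |-> v + t a (a^T J v) is symplectic because a^T J a = 0. It is affine in
    t, so t |-> X + t a a^T J X is a straight line inside the manifold, and
    a a^T J X is tangent for every column a. For N normal and a = E b, the
    equation g_rho(N, a a^T J X) = 0 says that the quadratic form with matrix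
    [[W_N^T / rho, K_N^T], [0, 0]] vanishes at b. A matrix whose quadratic form
    vanishes everywhere is skew, so K_N = 0 and W_N is skew: N = XJ W_N. *)

Set Implicit Arguments.
Unset Strict Implicit.

Local Open Scope classical_set_scope.
Local Open Scope ring_scope.

(** * The standard symplectic form *)

Lemma J2_tr (R : realType) (m : nat) : (J2 m)^T = - J2 m :> 'M[R]_(m + m).
Proof.
by rewrite /J2 tr_block_mx !trmx0 linearN /= trmx1 opp_block_mx !oppr0 opprK.
Qed.

Lemma J2_sqr (R : realType) (m : nat) : J2 m *m J2 m = - 1%:M :> 'M[R]_(m + m).
Proof.
rewrite /J2 mulmx_block !(mul0mx, mulmx0) mul1mx mulmx1 !(add0r, addr0).
by rewrite scalar_mx_block opp_block_mx !oppr0.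
Qed.

(** The scalar [a^T J a] equals its transpose, which is its opposite. *)
Lemma J2_isotropic (R : realType) (n : nat) (a : 'cV[R]_(n + n)) :
  a^T *m J2 n *m a = 0.
Proof.
have skew : (a^T *m J2 n *m a)^T = - (a^T *m J2 n *m a).
  by rewrite !trmx_mul trmxK J2_tr mulNmx mulmxN mulmxA.
apply/matrixP => i j; rewrite !ord1.
have := congr1 (fun M : 'M[R]_1 => M 0 0) skew.
rewrite [LHS]mxE [RHS]mxE => /eqP; rewrite -addr_eq0 -mulr2n mulrn_eq0/=.
by move=> /eqP ->; rewrite mxE.
Qed.

(** * Derivatives of matrix-valued functions *)

Lemma is_derive_mxP (R : realFieldType) (V : normedModType R) (m k : nat)
    (F : V -> 'M[R]_(m, k)) (t v : V) (dF : 'M[R]_(m, k)) :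
  is_derive t v F dF <-> forall i j, is_derive t v (fun x => F x i j) (dF i j).
Proof.
split=> [[Fd <-] i j|Fij].
  apply: DeriveDef; first by move/derivable_mxP: Fd; exact.
  by rewrite derive_mx// mxE.
have Fd : derivable F t v by apply/derivable_mxP => i j; have [] := Fij i j.
apply: DeriveDef => //; rewrite derive_mx//; apply/matrixP => i j.
by rewrite mxE; have [] := Fij i j.
Qed.

Lemma is_derive_trmx (R : realFieldType) (V : normedModType R) (m k : nat)
    (F : V -> 'M[R]_(m, k)) (t v : V) (dF : 'M[R]_(m, k)) :
  is_derive t v F dF -> is_derive t v (fun x => (F x)^T) dF^T.
Proof.
move=> /is_derive_mxP Fd; apply/is_derive_mxP => i j; rewrite mxE.
by under eq_fun do rewrite mxE; exact: Fd.
Qed.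

Lemma is_derive_mulmx (R : realFieldType) (V : normedModType R) (m k l : nat)
    (F : V -> 'M[R]_(m, k)) (G : V -> 'M[R]_(k, l)) (t v : V)
    (dF : 'M[R]_(m, k)) (dG : 'M[R]_(k, l)) :
  is_derive t v F dF -> is_derive t v G dG ->
  is_derive t v (fun x => F x *m G x) (dF *m G t + F t *m dG).
Proof.
move=> /is_derive_mxP Fd /is_derive_mxP Gd; apply/is_derive_mxP => i j.
have -> : (fun x => (F x *m G x) i j) =
    \sum_(r < k) ((fun x => F x i r) * (fun x => G x r j)).
  by apply/funext => x; rewrite fct_sumE mxE.
have -> : (dF *m G t + F t *m dG) i j =
    \sum_(r < k) (F t i r *: dG r j + G t r j *: dF i r).
  rewrite !mxE -big_split; apply: eq_bigr => r _ /=.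
  by rewrite addrC /GRing.scale/= [dF i r * _]mulrC.
by apply: is_derive_sum => r; apply: is_deriveM.
Qed.

(** * Skew-symmetric matrices *)

(** Polarization: expanding the form at [a + b] gives the antisymmetry of the
    bilinear form, which is then read at the standard basis vectors. *)
Lemma skew_of_quadratic_form0 (R : realType) (m : nat) (A : 'M[R]_m) :
  (forall a : 'cV[R]_m, a^T *m A *m a = 0) -> A^T = - A.
Proof.
move=> A0.
have bilin (a b : 'cV[R]_m) : a^T *m A *m b + b^T *m A *m a = 0.
  have := A0 (a + b).
  by rewrite [(a + b)^T]linearD/= !mulmxDl !mulmxDr !A0 add0r addr0.
have entry i j :
    ((delta_mx i 0 : 'cV[R]_m)^T *m A *m (delta_mx j 0 : 'cV[R]_m)) 0 0 = A i j.
  by rewrite trmx_delta -rowE -colE !mxE.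
apply/matrixP => i j; rewrite !mxE.
have := congr1 (fun M : 'M[R]_1 => M 0 0) (bilin (delta_mx i 0) (delta_mx j 0)).
by rewrite [LHS]mxE !entry mxE => /eqP; rewrite addrC addr_eq0 => /eqP.
Qed.

(** Transposition leaves the trace unchanged and turns the product into its
    opposite, up to cyclicity. *)
Lemma tr_skew_sym (R : realType) (m : nat) (A S : 'M[R]_m) :
  A^T = - A -> S^T = S -> \tr (A^T *m S) = 0.
Proof.
move=> AT ST; have neg : \tr (A^T *m S) = - \tr (A^T *m S).
  rewrite -[LHS]mxtrace_tr trmx_mul trmxK ST mxtrace_mulC.
  by rewrite -[A in LHS]opprK -AT mulNmx linearN.
by move/eqP: neg; rewrite -addr_eq0 -mulr2n mulrn_eq0 => /eqP.
Qed.

(** * Tangent vectors of the symplectic Stiefel manifold *)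

(** The linear terms in [t] cancel by the skewness of [J], and the quadratic one
    carries the factor [a^T J a = 0]. *)
Lemma sympl_stiefel_transvection (R : realType) (p n : nat)
    (X : 'M[R]_(n + n, p + p)) (a : 'cV[R]_(n + n)) (t : R) :
  sympl_stiefel X -> sympl_stiefel (X + t *: (a *m a^T *m J2 n *m X)).
Proof.
rewrite /sympl_stiefel /= => XJ.
set V := a *m a^T *m J2 n *m X.
have VT : V^T = - (X^T *m J2 n *m a *m a^T).
  by rewrite /V !trmx_mul trmxK J2_tr mulNmx mulmxN !mulmxA.
have VJV : V^T *m J2 n *m V = 0.
  rewrite VT /V !mulNmx !mulmxA.
  have -> : X^T *m J2 n *m a *m a^T *m J2 n *m a =
      X^T *m J2 n *m a *m (a^T *m J2 n *m a) by rewrite !mulmxA.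
  by rewrite J2_isotropic mulmx0 !mul0mx oppr0.
have cross : X^T *m J2 n *m V = - (V^T *m J2 n *m X).
  by rewrite VT /V !mulNmx opprK !mulmxA.
rewrite [(X + _)^T]linearD/= [(t *: V)^T]linearZ/= !mulmxDl !mulmxDr.
rewrite -!scalemxAl -!scalemxAr VJV.
by rewrite !scaler0 addr0 XJ cross scalerN -addrA addNr addr0.
Qed.

(** For a straight line the smoothness demanded at every order is automatic:
    the derivatives of order at least two vanish. *)
Lemma tangent_space_line (R : realType) (m k : nat) (M : set 'M[R]_(m, k))
    (X V : 'M[R]_(m, k)) :
  (forall t : R, M (X + t *: V)) -> tangent_space M X V.
Proof.
move=> MXV; pose gamma (t : R) : 'M[R]_(m, k) := X + t *: V.
have dgamma (t : R) : is_derive t 1 gamma V.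
  apply/is_derive_mxP => i j.
  have -> : (fun x => gamma x i j) = cst (X i j) + V i j \*: id.
    by apply/funext => x; rewrite /gamma !mxE /= mulrC.
  rewrite -[X in is_derive _ _ _ X]mulr1 -[X in is_derive _ _ _ X]add0r.
  exact: is_deriveD.
have gamma' : derive1 gamma = cst V.
  by apply/funext => t; rewrite derive1E; have [] := dgamma t.
have gamma'' i : derive1n i.+2 gamma = cst 0.
  elim: i => [|i IHi].
    by rewrite /derive1n/= gamma'; apply/funext => t; rewrite derive1_cst.
  by rewrite /derive1n iterS -/(derive1n _ _) IHi; apply/funext => t;
    rewrite derive1_cst.
exists 1, gamma; split.
- exact: ltr01.
- by move=> t _; exact: MXV.
- case=> [|[|i]] t _.
  + by have [] := dgamma t.
  + by rewrite /derive1n/= gamma'; exact: derivable_cst.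
  + by rewrite gamma''; exact: derivable_cst.
- by rewrite /gamma scale0r addr0.
- by rewrite gamma'.
Qed.

Lemma tangent_sympl_stiefel_linearized (R : realType) (p n : nat)
    (X Z : 'M[R]_(n + n, p + p)) :
  tangent_space (@sympl_stiefel R p n) X Z ->
  Z^T *m J2 n *m X + X^T *m J2 n *m Z = 0.
Proof.
move=> [e [gamma [e0 Mgamma smooth gamma0 gamma'0]]].
have dgamma : is_derive (0 : R) 1 gamma Z.
  apply: DeriveDef; last by rewrite -derive1E.
  by have := smooth 0%N 0; rewrite normr0; exact.
have dJ : is_derive (0 : R) (1 : R) (cst (J2 n : 'M[R]_(n + n))) 0.
  exact: is_derive_cst.
have := is_derive_mulmx (is_derive_mulmx (is_derive_trmx dgamma) dJ) dgamma.
rewrite mulmx0 addr0 /= gamma0 => -[_ <-].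
rewrite (@near_eq_derive _ _ _ _ (cst (J2 p))) ?derive_cst//.
near=> t; apply: Mgamma.
near: t; exact: (@nbhs0_lt R R^o).
Unshelve. all: by end_near. Qed.

(** * The frame [E] *)

Section Frame.
Variables (R : realType) (p n : nat) (le_pn : (p <= n)%N).
Variables (X : 'M[R]_(n + n, p + p)) (Xp : 'M[R]_(n + n, n + n - (p + p))).
Hypotheses (XJX : sympl_stiefel X) (Xperp : is_perp X Xp).

Local Notation E := (Emx X Xp).
Local Notation Ei := (Einv le_pn X Xp).

Lemma perp_tr_mul : X^T *m Xp = 0.
Proof.
apply/matrixP => i j; rewrite mxE.
have [_ span] := Xperp.
have : orth_compl (col_span X) (col j Xp).
  by rewrite -span; exists (delta_mx j 0) => //; rewrite -colE.
move=> /(_ (col i X)) /(_ (ex_intro2 _ _ (delta_mx i 0) I (esym (colE _ _)))).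
move=> /matrixP /(_ 0 0); rewrite !mxE => {2}<-.
by apply: eq_bigr => r _; rewrite !mxE.
Qed.

Lemma perp_inj (w : 'cV[R]_(n + n - (p + p))) : Xp *m w = 0 -> w = 0.
Proof.
have [rk _] := Xperp => Xpw.
apply: trmx_inj; apply: (@row_free_inj _ _ _ _ (Xp^T)).
  by rewrite /row_free mxrank_tr rk.
by rewrite trmx0 mul0mx -trmx_mul Xpw trmx0.
Qed.

(** The identity that makes [E] useful: [- X^T J] extracts the first block of
    coordinates, since [J^2 = -1] and the columns of [X] and [X_perp] are
    orthogonal. *)
Lemma XJ_Emx : X^T *m J2 n *m E = row_mx (- 1%:M) 0.
Proof.
rewrite /Emx mul_mx_row !mulmxA XJX J2_sqr -[X^T *m _ *m _]mulmxA J2_sqr.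
by rewrite mulmxN mulmx1 mulNmx perp_tr_mul oppr0.
Qed.

(** [X^T J] kills the second block of coordinates and negates the first one, so
    the first one is 0; the other is then 0 by the full rank of [X_perp]. *)
Lemma Emx_inj (v : 'cV[R]_(p + p + (n + n - (p + p)))) : E *m v = 0 -> v = 0.
Proof.
rewrite -[v]vsubmxK => Ev.
have u0 : usubmx v = 0.
  apply: oppr_inj; rewrite oppr0 -(mulmx0 _ (X^T *m J2 n)) -Ev mulmxA XJ_Emx.
  by rewrite mul_row_col mul0mx addr0 mulNmx mul1mx.
move: Ev; rewrite u0 /Emx mul_row_col mulmx0 add0r => JXpw.
rewrite (_ : dsubmx v = 0) ?col_mx0//; apply: perp_inj.
apply: oppr_inj; rewrite oppr0 -(mulmx0 _ (J2 n)) -JXpw !mulmxA J2_sqr.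
by rewrite !mulNmx mul1mx.
Qed.

(** Injectivity of [E] in terms of matrix ranks, which is the form from which
    invertibility follows once [E] is known to be square. *)
Lemma Emx_row_free_tr : row_free E^T.
Proof.
rewrite -kermx_eq0; apply/eqP/row_matrixP => i; rewrite row0.
apply: trmx_inj; rewrite trmx0; apply: Emx_inj.
apply: trmx_inj; rewrite trmx_mul trmxK trmx0 -row_mul mulmx_ker row0.
by [].
Qed.

End Frame.

(** An arbitrary equation [k = m] between variables can be eliminated, so that
    the casts in the definition of [Einv] disappear. *)
Lemma cast_invmxK (R : realType) (k m : nat) (e : k = m) (A : 'M[R]_(m, k)) :
  row_free A^T ->
  let Ai := castmx (esym e, erefl) (invmx (castmx (erefl, e) A)) in
  A *m Ai = 1%:M /\ Ai *m A = 1%:M.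
Proof.
case: m / e A => A; rewrite row_free_unit unitmx_tr => uA /=.
by rewrite !castmx_id mulmxV ?mulVmx.
Qed.

(** * The metric and the normal space *)

(** The two traces are those of the blocks of one product. This form makes
    [g_rho N] a single trace against [E^-1 Z], to which cyclicity applies. *)
Lemma g_rhoE (R : realType) (p n : nat) (le_pn : (p <= n)%N) (rho : R)
    (X : 'M[R]_(n + n, p + p)) (Xp : 'M[R]_(n + n, n + n - (p + p)))
    (Z1 Z2 : 'M[R]_(n + n, p + p)) :
  g_rho le_pn rho X Xp Z1 Z2 =
  \tr (row_mx (rho^-1 *: (Wpart le_pn X Xp Z1)^T) (Kpart le_pn X Xp Z1)^T
       *m (Einv le_pn X Xp *m Z2)).
Proof.
rewrite -[Einv _ _ _ *m Z2]vsubmxK mul_row_col mxtraceD -scalemxAl.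
by rewrite mxtraceZ.
Qed.

Unset Implicit Arguments.
Set Strict Implicit.

Theorem proposition4p2 (R : realType) (p n : nat) (p_gt0 : (0 < p)%N)
    (le_pn : (p <= n)%N) (rho : R) (rho_gt0 : 0 < rho)
    (X : 'M[R]_(n + n, p + p)) (Xp : 'M[R]_(n + n, n + n - (p + p))) :
  sympl_stiefel X -> is_perp X Xp ->
  normal_space_rho le_pn rho X Xp =
    [set X *m J2 p *m Omega | Omega in @skew_mx R (p + p)].
Proof.
move=> XJX Xperp.
have XJE := XJ_Emx XJX Xperp.
have [EEi EiE] := cast_invmxK (dimE le_pn) (Emx_row_free_tr XJX Xperp).
rewrite -/(Einv le_pn X Xp) in EEi EiE.
have EJX : (Emx X Xp)^T *m J2 n *m X = col_mx 1%:M 0.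
  apply: trmx_inj; rewrite !trmx_mul trmxK J2_tr mulNmx mulmxN mulmxA XJE.
  by rewrite tr_col_mx opp_row_mx opprK oppr0 trmx1 trmx0.
apply/seteqP; split=> [N Nnormal | _ [ Omega Oskew <-] Z Ztan]; last first.
  (* XJ Omega has frame coordinates (Omega, 0), and Z has a symmetric first
     coordinate. *)
  have EiN : Einv le_pn X Xp *m (X *m J2 p *m Omega) = col_mx Omega 0.
    have -> : X *m J2 p *m Omega = Emx X Xp *m col_mx Omega 0.
      by rewrite /Emx mul_row_col mulmx0 addr0.
    by rewrite mulmxA EiE mul1mx.
  have XJZ : X^T *m J2 n *m Z = - Wpart le_pn X Xp Z.
    rewrite -[Z in LHS]mul1mx -EEi -(mulmxA (Emx X Xp)) mulmxA XJE.
    by rewrite -[Einv _ _ _ *m Z]vsubmxK mul_row_col mul0mx addr0 mulNmx mul1mx.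
  have Wsym : (Wpart le_pn X Xp Z)^T = Wpart le_pn X Xp Z.
    have := tangent_sympl_stiefel_linearized Ztan; rewrite XJZ.
    have -> : Z^T *m J2 n *m X = - (X^T *m J2 n *m Z)^T.
      by rewrite !trmx_mul trmxK J2_tr mulNmx mulmxN opprK mulmxA.
    by rewrite XJZ linearN/= opprK => /eqP; rewrite subr_eq0 => /eqP.
  rewrite /g_rho {1}/Wpart {1}/Kpart EiN col_mxKu col_mxKd trmx0 mul0mx.
  by rewrite mxtrace0 addr0 tr_skew_sym// mulr0.
set W := Wpart le_pn X Xp N; set K := Kpart le_pn X Xp N.
have skew : (block_mx (rho^-1 *: W^T) K^T 0 0)^T =
    - block_mx (rho^-1 *: W^T) K^T 0 0.
  apply: skew_of_quadratic_form0 => b.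
  (* The substitution a = E b turns E^-1 a into b and a^T J X into the first
     block of b^T. *)
  pose a := Emx X Xp *m b.
  have := Nnormal _ (tangent_space_line
    (fun t => sympl_stiefel_transvection a t XJX)).
  rewrite g_rhoE -/W -/K.
  have -> : Einv le_pn X Xp *m (a *m a^T *m J2 n *m X) =
      b *m (b^T *m col_mx 1%:M 0).
    by rewrite -EJX /a trmx_mul !mulmxA EiE mul1mx.
  rewrite (mulmxA (row_mx _ _)) mxtrace_mulC mulmxA -(mulmxA b^T (col_mx _ _)).
  rewrite mul_col_row !mul1mx !mul0mx => tr0.
  by apply/matrixP => i j; rewrite !ord1 [RHS]mxE -tr0 /mxtrace big_ord1.
move: skew; rewrite tr_block_mx opp_block_mx !trmx0 trmxK oppr0.
move=> /eq_block_mx[Wskew _ K0 _].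
exists W.
  move: Wskew; rewrite linearZ/= trmxK -scalerN.
  move=> /(scalerI (invr_neq0 (lt0r_neq0 rho_gt0))).
  by move=> WE; rewrite /skew_mx /= [in RHS]WE opprK.
rewrite -[RHS]mul1mx -EEi -(mulmxA (Emx X Xp)) -[Einv _ _ _ *m N]vsubmxK.
rewrite -/(Wpart le_pn X Xp N) -/(Kpart le_pn X Xp N) -/W -/K K0.
by rewrite /Emx mul_row_col mulmx0 addr0.
Qed.
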